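(* Consider the regression model $Y=f(W,X)+\varepsilon$ with two-layer network $f(W,x)=1_p^\top\sigma(Wx)=\sum_{i=1}^p\sigma(W_i^\top x)$, where $x\in\mathbb{R}^d$, $W\in\mathbb{R}^{p\times d}$ has rows $W_i$, $\sigma$ is applied elementwise, and the network is trained with the least-squares loss $(Y-f(W,X))^2$. Let $\nabla f(W,x)=\sigma'(Wx)x^\top\in\mathbb{R}^{p\times d}$ and define the Fisher information tensor $I_W=\mathbb{E}[\nabla f(W,X)\otimes\nabla f(W,X)]$ (a $p^2\times d^2$ array with entries $I_W((i,i'),(j,j'))=\mathbb{E}[\sigma'(W_i^\top X)\sigma'(W_{i'}^\top X)X_jX_{j'}]$). Let $G=\{g_0,\dots,g_{d-1}\}$ be the group of circular shifts of $\mathbb{R}^d$, $(g_ix)_{(j+i)\bmod d}=x_j$, with the uniform distribution $\mathbb{Q}$, and let $\bar I_W=\mathbb{E}_X\big[(\mathbb{E}_{g}\nabla f(W,gX))\otimes(\mathbb{E}_g\nabla f(W,gX))\big]$. Then: 1. $I_W=\mathbb{E}\big[(\sigma'(WX)\otimes\sigma'(WX))\cdot(X\otimes X)^\top\big]$; if moreover $\sigma(u)=u^2/2$, then $I_W=(W\otimes W)\cdot\mathbb{E}(XX^\top\otimes XX^\top)$. 2. Assume $\sigma(u)=u^2/2$. For $v\in\mathbb{R}^d$ let $C_v$ be the circulant matrix with entries $C_v(i,j)=v_{i-j+1}$ (indices modulo $d$, taken in $\{1,\dots,d\}$). Then $\bar I_W=(W\otimes W)\cdot d^{-2}\,\mathbb{E}(C_XC_X^\top\otimes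 C_XC_X^\top)$. If furthermore $X\sim\mathcal{N}(0,I_d)$, then $$\bar I_W=(W\otimes W)\cdot F_2^*\cdot(F_2^2\odot M)\cdot F_2^*,$$ where $F$ is the $d\times d$ DFT matrix with entries $F_{j,k}=d^{-1/2}\exp(-2\pi\mathrm{i}(j-1)(k-1)/d)$ and rows $F_1,\dots,F_d$, $F_2=F\otimes F$, $F_2^2=F_2F_2$, $F_2^*$ is the entrywise complex conjugate of $F_2$, $\odot$ is the entrywise product, and $M$ is the $d^2\times d^2$ matrix with rows indexed by $(i,j)$, columns by $(i',j')$, and entries $$M_{iji'j'}=F_i^\top F_j\cdot F_{i'}^\top F_{j'}+F_i^\top F_{j'}\cdot F_{i'}^\top F_j+F_i^\top F_{i'}\cdot F_j^\top F_{j'}.$$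
   Context: $\otimes$ denotes the Kronecker product; for $p\times d$ matrices $A,B$, $A\otimes B$ is the $p^2\times d^2$ array with entries $(A\otimes B)((i,i'),(j,j'))=A_{ij}B_{i'j'}$. All expectations are assumed finite. *)

(* Defs.v *)
From mathcomp Require Import all_boot all_order all_algebra.
From mathcomp Require Import all_classical all_reals all_analysis.
From mathcomp Require Export complex mxtens.
Set Implicit Arguments. Unset Strict Implicit. Unset Printing Implicit Defensive.
Import Order.TTheory GRing.Theory Num.Theory.
Local Open Scope ring_scope.

Section Defs.
Context {R : realType}.

Definition Emx {dT} {T : measurableType dT} (P : probability T R) {m n : nat}
  (Y : T -> 'M[R]_(m, n)) : 'M[R]_(m, n) :=
  \matrix_(i, j) fine ('E_P[fun w => Y w i j])%E.

Definition net {p d : nat} (sigma : R -> R) (W : 'M[R]_(p, d)) (x : 'cV[R]_d) : R :=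
  \sum_(i < p) sigma ((W *m x) i 0).

Definition gradf {p d : nat} (sigma : R -> R) (W : 'M[R]_(p, d)) (x : 'cV[R]_d)
  : 'M[R]_(p, d) :=
  map_mx (derive1 sigma) (W *m x) *m x^T.

(* Fisher information tensor I_W = E[nabla f(W,X) (x) nabla f(W,X)],
   a (p*p) x (d*d) matrix; index (i,i') is encoded by mxtens_index. *)
Definition Fisher {dT} {T : measurableType dT} (P : probability T R) {p d : nat}
  (X : T -> 'cV[R]_d) (sigma : R -> R) (W : 'M[R]_(p, d)) : 'M[R]_(p * p, d * d) :=
  Emx P (fun w => gradf sigma W (X w) *t gradf sigma W (X w)).

(* k mod d as an element of 'I_d (d > 0 is witnessed by i0 : 'I_d) *)
Definition ordmod {d : nat} (i0 : 'I_d) (k : nat) : 'I_d :=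
  Ordinal (ltn_pmod k (leq_ltn_trans (leq0n i0) (ltn_ord i0))).

(* circular shift g_i : (g_i x)_{(j+i) mod d} = x_j, i.e. (g_i x)_k = x_{(k-i) mod d} *)
Definition cshift {d : nat} (i : 'I_d) (x : 'cV[R]_d) : 'cV[R]_d :=
  \col_(k < d) x (ordmod k (k + (d - i))) 0.

Definition avg_gradf {p d : nat} (sigma : R -> R) (W : 'M[R]_(p, d)) (x : 'cV[R]_d)
  : 'M[R]_(p, d) :=
  (d%:R)^-1 *: \sum_(i < d) gradf sigma W (cshift i x).

Definition Fisher_bar {dT} {T : measurableType dT} (P : probability T R) {p d : nat}
  (X : T -> 'cV[R]_d) (sigma : R -> R) (W : 'M[R]_(p, d)) : 'M[R]_(p * p, d * d) :=
  Emx P (fun w => avg_gradf sigma W (X w) *t avg_gradf sigma W (X w)).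

(* circulant matrix C_v(i,j) = v_{(i-j) mod d}  (0-based indices) *)
Definition circulant {d : nat} (v : 'cV[R]_d) : 'M[R]_d :=
  \matrix_(i < d, j < d) v (ordmod i (i + (d - j))) 0.

Definition std_gaussian_vec {dT} {T : measurableType dT} (P : probability T R)
  {d : nat} (X : T -> 'cV[R]_d) : Prop :=
  forall A : 'I_d -> set R, (forall j, measurable (A j)) ->
    P (\bigcap_j ((fun w => X w j 0) @^-1` A j))%classic
    = (\prod_(j < d) normal_prob 0 1 (A j))%E.

Definition dft (d : nat) : 'M[R[i]]_d :=
  \matrix_(j < d, k < d)
    (let th := 2 * pi * (j%:R * k%:R) / d%:R in
     ((Num.sqrt (d%:R))^-1)%:C * (Complex (cos th) (- sin th)))%C.

Definition conj_mx {m n : nat} (A : 'M[R[i]]_(m, n)) : 'M[R[i]]_(m, n) :=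
  map_mx Num.conj A.

Definition hadamard {m n : nat} (A B : 'M[R[i]]_(m, n)) : 'M[R[i]]_(m, n) :=
  map2_mx (fun a b => a * b) A B.

(* F_i^T F_j for rows of F (bilinear, no conjugation) *)
Definition rowdot {d : nat} (F : 'M[R[i]]_d) (i j : 'I_d) : R[i] :=
  \sum_(k < d) F i k * F j k.

Definition Mmat (d : nat) : 'M[R[i]]_(d * d) :=
  let F := dft d in
  \matrix_(a, b)
    (let i := (mxtens_unindex a).1 in let j := (mxtens_unindex a).2 in
     let i' := (mxtens_unindex b).1 in let j' := (mxtens_unindex b).2 in
     rowdot F i j * rowdot F i' j' + rowdot F i j' * rowdot F i' j
     + rowdot F i i' * rowdot F j j').

Definition cmx {m n : nat} (A : 'M[R]_(m, n)) : 'M[R[i]]_(m, n) :=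
  map_mx (fun r => (r%:C)%C) A.

End Defs.

(* Main.v *)
(* Parts 1 and 2 for the quadratic activation follow from the mixed-product rule
   of the Kronecker product and linearity of the expectation: sigma' is the
   identity, so the gradient is W x x^T, and the average of (g x)(g x)^T over
   the shifts g is d^-1 C_x C_x^T because the shifts of x are the columns of
   C_x.

   In the Gaussian case both sides are computed entrywise. Isserlis' formula for
   fourth moments turns d^-2 E(C_X C_X^T (x) C_X C_X^T) at ((a,b),(a',b')) into
     [a = a'][b = b'] + d^-1 [a + b = a' + b'] + d^-1 [a - b = a' - b']  (mod d).
   On the other side F^2 is the permutation matrix of i |-> -i, so that
   F_2^2 (.) M = D F_2^2 with D diagonal of entries 1 + [i = j] + [i + j = 0], and
   F_2^* D F_2^2 F_2^* = F_2^* D F_2 is evaluated by orthogonality of characters.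

   Isserlis' formula is reduced to the moments of N(0,1): rectangles determine
   the expectation of a product of functions of the coordinates, by replacing
   indicators by integrable functions one coordinate at a time. *)
Require Import Defs.
From mathcomp Require Import all_boot all_order all_algebra.
From mathcomp Require Import all_classical all_reals all_analysis.
From mathcomp Require Import measurable_realfun complex mxtens.
From mathcomp Require Import ring lra.
Set Implicit Arguments. Unset Strict Implicit. Unset Printing Implicit Defensive.
Import Order.TTheory GRing.Theory Num.Theory.
Import numFieldNormedType.Exports.
Local Open Scope classical_set_scope.
Local Open Scope ring_scope.

(** * Expectation of products over an i.i.d. family *)

Section density_transfer.
Local Open Scope ereal_scope.
Context d d' (T : measurableType d) (S : measurableType d') (R : realType).
Variables (mu : {measure set T -> \bar R}) (nu : {measure set S -> \bar R}).
Variables (Z : T -> S) (mZ : measurable_fun [set: T] Z).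

Import HBNNSimple.

Lemma ge0_integral_density_transfer (H : T -> R) (c : R) (f : S -> R) :
  measurable_fun [set: T] H -> (forall w, 0 <= H w)%R ->
  (forall A, measurable A -> \int[mu]_w (\1_A (Z w) * H w)%:E = c%:E * nu A) ->
  measurable_fun [set: S] f -> (forall x, 0 <= f x)%R -> (0 <= c)%R ->
  \int[mu]_w (f (Z w) * H w)%:E = c%:E * \int[nu]_x (f x)%:E.
Proof.
move=> mH H0 HA mf f0 c0.
have mEf : measurable_fun [set: S] (fun x => (f x)%:E) by exact/measurable_EFinP.
pose f_ := nnsfun_approx measurableT mEf.
have mfZ n : measurable_fun [set: T] (fun w => f_ n (Z w)).
  exact: (measurableT_comp _ mZ).
have cvf (x : S) : EFin \o f_ ^~ x @ \oo --> (f x)%:E.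
  by apply: cvg_nnsfun_approx => // y _; rewrite lee_fin.
have ndf x m n : (m <= n)%N -> (f_ m x <= f_ n x)%R.
  by move=> mn; exact/lefP/nd_nnsfun_approx.
have step n : \int[mu]_w (f_ n (Z w) * H w)%:E = c%:E * \int[nu]_x (f_ n x)%:E.
  have mpre k : measurable (f_ n @^-1` [set k]) by exact: measurable_sfunP.
  have mind k : measurable_fun [set: T] (fun w => \1_(f_ n @^-1` [set k]) (Z w) : R).
    apply: (measurableT_comp _ mZ); exact: measurable_indic.
  transitivity (\sum_(k \in range (f_ n))
      \int[mu]_w (k * (\1_(f_ n @^-1` [set k]) (Z w) * H w))%:E).
    rewrite -ge0_integral_fsum//; last 2 first.
    - by move=> r; apply/measurable_EFinP/measurable_funM => //; exact: measurable_funM.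
    - move=> r w _; rewrite mulrA EFinM mule_ge0// ?lee_fin//.
      by have := nnfun_muleindic_ge0 (f_ n) r (Z w); rewrite lee_fin.
    apply: eq_integral => w _; rewrite fsumEFin//; congr EFin.
    rewrite [X in (X * _)%R]fimfunE mulr_fsuml//.
    by apply: eq_fsbigr => k _; rewrite mulrA.
  transitivity (\sum_(k \in range (f_ n)) c%:E * (k%:E * nu (f_ n @^-1` [set k]))).
    apply: eq_fsbigr => k; rewrite inE => -[x _ fxk].
    have k0 : (0 <= k)%R by rewrite -fxk.
    under eq_integral do rewrite EFinM.
    rewrite ge0_integralZl//; last 2 first.
    - by apply/measurable_EFinP/measurable_funM.
    - by move=> w _; rewrite lee_fin mulr_ge0.
    by rewrite muleCA -HA.
  rewrite integralT_nnsfun sintegralE ge0_mule_fsumr//.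
  by move=> r; exact: nnsfun_mulemu_ge0.
transitivity (limn (fun n => \int[mu]_w (f_ n (Z w) * H w)%:E)).
  rewrite -monotone_convergence//.
  - apply: eq_integral => w _; apply/esym/cvg_lim => //.
    under eq_fun do rewrite EFinM.
    rewrite EFinM; apply: cvgeZr => //; exact: cvf.
  - by move=> n; apply/measurable_EFinP/measurable_funM.
  - by move=> n w _; rewrite lee_fin mulr_ge0.
  - by move=> w _ m n mn; rewrite lee_fin ler_wpM2r// ndf.
under eq_fun do rewrite step.
apply/cvg_lim => //; apply: cvgeZl => //.
rewrite [X in _ --> X](_ : _ = \int[nu]_x limn (fun n => (f_ n x)%:E)).
  apply: cvg_monotone_convergence => //.
  - by move=> n; exact/measurable_EFinP.
  - by move=> n x _; rewrite lee_fin.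
  - by move=> x _ m n mn; rewrite lee_fin ndf.
by apply: eq_integral => x _; apply/esym/cvg_lim => //; exact: cvf.
Qed.

End density_transfer.

Lemma EFin_Rintegral d (T : measurableType d) (R : realType)
    (mu : {measure set T -> \bar R}) (H : T -> R) :
  mu.-integrable [set: T] (EFin \o H) ->
  (\int[mu]_w (H w)%:E = (\int[mu]_w H w)%R%:E)%E.
Proof. by move=> iH; rewrite /Rintegral fineK//; exact: integrable_fin_num. Qed.

Lemma integrableD_EFin d (T : measurableType d) (R : realType)
    (mu : {measure set T -> \bar R}) (f g : T -> R) :
  mu.-integrable [set: T] (EFin \o f) -> mu.-integrable [set: T] (EFin \o g) ->
  mu.-integrable [set: T] (EFin \o (fun w => f w + g w)).
Proof. by move=> fi gi; exact: (integrableD measurableT fi gi). Qed.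

Lemma integrableB_EFin d (T : measurableType d) (R : realType)
    (mu : {measure set T -> \bar R}) (f g : T -> R) :
  mu.-integrable [set: T] (EFin \o f) -> mu.-integrable [set: T] (EFin \o g) ->
  mu.-integrable [set: T] (EFin \o (fun w => f w - g w)).
Proof. by move=> fi gi; exact: (integrableB measurableT fi gi). Qed.

Lemma integrableZ_EFin d (T : measurableType d) (R : realType)
    (mu : {measure set T -> \bar R}) (k : R) (f : T -> R) :
  mu.-integrable [set: T] (EFin \o f) ->
  mu.-integrable [set: T] (EFin \o (fun w => k * f w)).
Proof. by move=> fi; exact: (integrableZl measurableT k fi). Qed.

Section signed_density_transfer.
Context d d' (T : measurableType d) (S : measurableType d') (R : realType).
Variables (mu : {measure set T -> \bar R}) (nu : probability S R).
Variables (Z : T -> S) (mZ : measurable_fun [set: T] Z).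

Lemma integrable_indicM (H : T -> R) (A : set S) : measurable A ->
  mu.-integrable [set: T] (EFin \o H) ->
  mu.-integrable [set: T] (EFin \o (fun w => \1_A (Z w) * H w)).
Proof.
move=> mA iH; apply: (le_integrable _ _ _ iH) => //.
- apply/measurable_EFinP/measurable_funM.
    by apply: (measurableT_comp _ mZ); exact: measurable_indic.
  by apply/measurable_EFinP; exact: measurable_int iH.
- move=> w _; rewrite lee_fin normrM ler_piMl// indicE.
  by case: (_ \in _); rewrite ?normr1 ?normr0.
Qed.

Let density_factor (H : T -> R) (c : R) := forall A, measurable A ->
  \int[mu]_w (\1_A (Z w) * H w) = c * fine (nu A).

Let transfers (f : S -> R) (H : T -> R) (c : R) :=
  mu.-integrable [set: T] (EFin \o (fun w => f (Z w) * H w)) /\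
  \int[mu]_w (f (Z w) * H w) = c * \int[nu]_x f x.

Let transfer_ge0 (H : T -> R) (c : R) (f : S -> R) :
  mu.-integrable [set: T] (EFin \o H) -> (forall w, 0 <= H w) ->
  density_factor H c ->
  nu.-integrable [set: S] (EFin \o f) -> (forall x, 0 <= f x) ->
  transfers f H c.
Proof.
move=> iH H0 HA iF f0.
have mH : measurable_fun [set: T] H.
  by apply/measurable_EFinP; exact: measurable_int iH.
have mf : measurable_fun [set: S] f.
  by apply/measurable_EFinP; exact: measurable_int iF.
have c0 : 0 <= c.
  have := HA _ measurableT; rewrite probability_setT/= mulr1 => <-.
  by apply: Rintegral_ge0 => w _; rewrite mulr_ge0.
have E : (\int[mu]_w (f (Z w) * H w)%:E = (c * \int[nu]_x f x)%:E)%E.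
  rewrite (@ge0_integral_density_transfer _ _ _ _ _ mu nu Z mZ H c f)//.
    by rewrite EFinM; congr *%E; exact: EFin_Rintegral.
  move=> A mA; rewrite EFin_Rintegral ?HA//; last exact: integrable_indicM.
  by rewrite EFinM fineK// fin_num_measure.
split; last by rewrite /Rintegral E.
apply/integrableP; split.
  by apply/measurable_EFinP/measurable_funM => //; exact: measurableT_comp.
under eq_integral do rewrite /= ger0_norm ?mulr_ge0//.
by rewrite E ltry.
Qed.

Let transfer_ge0l (H : T -> R) (c c' : R) (f : S -> R) :
  mu.-integrable [set: T] (EFin \o H) ->
  density_factor H c -> density_factor (fun w => `|H w|) c' ->
  nu.-integrable [set: S] (EFin \o f) -> (forall x, 0 <= f x) ->
  transfers f H c.
Proof.
move=> iH HA HA' iF f0.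
have iN := integrable_norm iH.
have iD : mu.-integrable [set: T] (EFin \o (fun w => `|H w| + H w)).
  exact: integrableD_EFin.
have iB : mu.-integrable [set: T] (EFin \o (fun w => `|H w| - H w)).
  exact: integrableB_EFin.
have [|A mA|iP eP] := @transfer_ge0 _ (c' + c) f iD _ _ iF f0.
- by move=> w; rewrite -lerBlDr sub0r -normrN ler_norm.
- under eq_Rintegral do rewrite mulrDr.
  by rewrite RintegralD ?HA ?HA' ?mulrDl//; exact: integrable_indicM.
have [|A mA|iM eM] := @transfer_ge0 _ (c' - c) f iB _ _ iF f0.
- by move=> w; rewrite subr_ge0 ler_norm.
- under eq_Rintegral do rewrite mulrBr.
  by rewrite RintegralB ?HA ?HA' ?mulrBl//; exact: integrable_indicM.
have E w : f (Z w) * H w =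
    2^-1 * (f (Z w) * (`|H w| + H w) - f (Z w) * (`|H w| - H w)).
  by field.
have iPM : mu.-integrable [set: T] (EFin \o
    (fun w => f (Z w) * (`|H w| + H w) - f (Z w) * (`|H w| - H w))).
  exact: integrableB_EFin.
split.
  under eq_fun do rewrite /= E.
  exact: integrableZ_EFin.
under eq_Rintegral do rewrite E.
rewrite RintegralZl// RintegralB// eP eM.
by field.
Qed.

Lemma integrable_transfer (H : T -> R) (c c' : R) (f : S -> R) :
  mu.-integrable [set: T] (EFin \o H) ->
  (forall A, measurable A -> \int[mu]_w (\1_A (Z w) * H w) = c * fine (nu A)) ->
  (forall A, measurable A ->
    \int[mu]_w (\1_A (Z w) * `|H w|) = c' * fine (nu A)) ->
  nu.-integrable [set: S] (EFin \o f) ->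
  mu.-integrable [set: T] (EFin \o (fun w => f (Z w) * H w)) /\
  \int[mu]_w (f (Z w) * H w) = c * \int[nu]_x f x.
Proof.
move=> iH HA HA' iF.
have iN := integrable_norm iF.
have iD : nu.-integrable [set: S] (EFin \o (fun x => `|f x| + f x)).
  exact: integrableD_EFin.
have iB : nu.-integrable [set: S] (EFin \o (fun x => `|f x| - f x)).
  exact: integrableB_EFin.
have [|iP eP] := transfer_ge0l iH HA HA' iD.
  by move=> x; rewrite -lerBlDr sub0r -normrN ler_norm.
have [|iM eM] := transfer_ge0l iH HA HA' iB.
  by move=> x; rewrite subr_ge0 ler_norm.
have E w : f (Z w) * H w =
    2^-1 * ((`|f (Z w)| + f (Z w)) * H w - (`|f (Z w)| - f (Z w)) * H w).
  by field.
have iPM : mu.-integrable [set: T] (EFin \o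
    (fun w => (`|f (Z w)| + f (Z w)) * H w - (`|f (Z w)| - f (Z w)) * H w)).
  exact: integrableB_EFin.
split.
  under eq_fun do rewrite /= E.
  exact: integrableZ_EFin.
under eq_Rintegral do rewrite E.
rewrite RintegralZl// RintegralB// eP eM RintegralD// RintegralB//.
by field.
Qed.

End signed_density_transfer.

Section product_expectation.
Context dT (T : measurableType dT) (R : realType) (P : probability T R).
Context d' (S : measurableType d') (nu : probability S R) (d : nat).
Variables (X : 'I_d -> T -> S) (mX : forall j, measurable_fun [set: T] (X j)).
Hypothesis X_iid : forall A : 'I_d -> set S, (forall j, measurable (A j)) ->
  P (\bigcap_j (X j @^-1` A j)) = (\prod_(j < d) nu (A j))%E.

(* The factors are released from indicators to integrable functions one
   coordinate at a time; [k] counts those already released. *)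
Lemma expectation_prod_iid_rec (k : nat) (f : 'I_d -> S -> R) :
  (forall j, nu.-integrable [set: S] (EFin \o f j)) ->
  (forall j : 'I_d, (k <= j)%N -> exists2 A, measurable A & f j = \1_A) ->
  P.-integrable [set: T] (EFin \o (fun w => \prod_(j < d) f j (X j w))) /\
  \int[P]_w (\prod_(j < d) f j (X j w)) = \prod_(j < d) \int[nu]_x f j x.
Proof.
elim: k f => [|k IH] f iF fA.
  have [A AE] : {A : 'I_d -> set S & forall j, measurable (A j) /\ f j = \1_(A j)}.
    apply: (@choice _ _ (fun j B => measurable B /\ f j = \1_B)) => j.
    by have [B mB ->] := fA j (leq0n j); exists B.
  have mA j : measurable (A j) by have [] := AE j.
  have mXA : measurable (\bigcap_j (X j @^-1` A j)).
    apply: fin_bigcap_measurable => // j _.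
    by rewrite -[_ @^-1` _]setTI; exact: mX.
  have E w : \prod_(j < d) f j (X j w) = \1_(\bigcap_j (X j @^-1` A j)) w.
    rewrite indicE; have [/set_mem wA|wA] := boolP (w \in _).
      apply: big1 => j _; have [_ ->] := AE j.
      by rewrite indicE mem_set//; exact: wA.
    have [j wAj] : exists j, ~ A j (X j w).
      apply/existsNP => H; move/negP: wA; apply; apply/mem_set => j _; exact: H.
    rewrite (bigD1 j)//=; have [_ ->] := AE j.
    by rewrite indicE memNset// mul0r.
  split.
    under eq_fun do rewrite /= E.
    exact: integrable_indic.
  under eq_Rintegral do rewrite E.
  rewrite /Rintegral integral_indic//= setIT X_iid//.
  rewrite (eq_bigr (fun j => (fine (nu (A j)))%:E)); last first.
    by move=> j _; rewrite fineK// fin_num_measure.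
  rewrite prodEFin/=.
  by apply: eq_bigr => j _; have [mAj ->] := AE j; rewrite integral_indic//= setIT.
have [kd|kd] := leqP d k.
  by apply: IH => // j kj; have := leq_ltn_trans kj (ltn_ord j); rewrite ltnNge kd.
pose K := Ordinal kd.
have key (g : 'I_d -> S -> R) (A : set S) :
    (forall j, nu.-integrable [set: S] (EFin \o g j)) ->
    (forall j : 'I_d, (k < j)%N -> exists2 A, measurable A & g j = \1_A) ->
    measurable A ->
    P.-integrable [set: T] (EFin \o
      (fun w => \1_A (X K w) * \prod_(j < d | j != K) g j (X j w))) /\
    \int[P]_w (\1_A (X K w) * \prod_(j < d | j != K) g j (X j w)) =
      \prod_(j < d | j != K) (\int[nu]_x g j x) * fine (nu A).
  move=> iG gA mA; pose g' j := if j == K then \1_A else g j.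
  have E w : \prod_(j < d) g' j (X j w) =
      \1_A (X K w) * \prod_(j < d | j != K) g j (X j w).
    rewrite (bigD1 K)//= /g' eqxx; congr (_ * _).
    by apply: eq_bigr => j /negPf ->.
  have [j|j kj|i' e'] := IH g'.
  - by rewrite /g'; case: eqP => // _; exact: integrable_indic.
  - rewrite /g'; have [_|jK] := eqVneq j K; first by exists A.
    by apply: gA; rewrite ltn_neqAle kj andbT eq_sym.
  split; first by under eq_fun do rewrite /= -E.
  under eq_Rintegral do rewrite -E.
  rewrite e' (bigD1 K)//= mulrC; congr (_ * _).
    by apply: eq_bigr => j /negPf jK; rewrite /g' jK.
  by rewrite /g' eqxx /Rintegral integral_indic//= setIT.
have iH : P.-integrable [set: T]
    (EFin \o (fun w => \prod_(j < d | j != K) f j (X j w))).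
  have [] := key f _ iF fA measurableT.
  by under eq_fun do rewrite /= indicE in_setT mul1r.
have [A mA|A mA|iP eP] := @integrable_transfer _ _ _ _ _ P nu (X K) (mX K) _
  (\prod_(j < d | j != K) \int[nu]_x f j x)
  (\prod_(j < d | j != K) \int[nu]_x `|f j x|) (f K) iH _ _ (iF K).
- by have [] := key f A iF fA mA.
- under eq_Rintegral do rewrite normr_prod.
  have [j|j kj|//|_ ->//] := key (fun j x => `|f j x|) A.
    exact: integrable_norm.
  have [B mB ->] := fA j kj; exists B => //.
  by apply/funext => x; rewrite indicE; case: (_ \in _); rewrite ?normr1 ?normr0.
have E w : \prod_(j < d) f j (X j w) =
    f K (X K w) * \prod_(j < d | j != K) f j (X j w) by rewrite (bigD1 K).
split; first by under eq_fun do rewrite /= E.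
by under eq_Rintegral do rewrite E; rewrite eP [RHS](bigD1 K)//= mulrC.
Qed.

Lemma expectation_prod_iid (f : 'I_d -> S -> R) :
  (forall j, nu.-integrable [set: S] (EFin \o f j)) ->
  P.-integrable [set: T] (EFin \o (fun w => \prod_(j < d) f j (X j w))) /\
  \int[P]_w (\prod_(j < d) f j (X j w)) = \prod_(j < d) \int[nu]_x f j x.
Proof.
move=> iF; apply: (@expectation_prod_iid_rec d) => // j.
by rewrite leqNgt ltn_ord.
Qed.

End product_expectation.

(** * Moments of the standard normal law *)

Section standard_normal_moments.
Context {R : realType}.
Notation mu := (@lebesgue_measure R).
Local Notation phi := (@normal_pdf R 0 1).
Local Notation gauss := (normal_prob 0 1 : probability (measurableTypeR R) R).

Lemma normal_pdf01E (x : R) : phi x = normal_peak 1 * expR (- 2^-1 * x ^+ 2).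
Proof.
rewrite normal_pdfE ?oner_neq0// /normal_fun subr0 expr1n.
by congr (_ * expR _); field.
Qed.

Lemma normal_pdf01N (x : R) : phi (- x) = phi x.
Proof. by rewrite !normal_pdf01E sqrrN. Qed.

Lemma is_derive_normal_pdf01 (x : R) : is_derive x 1 phi (- (x * phi x)).
Proof.
have -> : phi = normal_peak 1 \*: (expR \o (- 2^-1 \*: ((@id R) ^+ 2))).
  by apply/funext => y; rewrite normal_pdf01E.
apply: is_derive_eq.
by rewrite /= /GRing.scale/=; field.
Qed.

Lemma ge0_integral_normal01 (f : R -> R) :
  measurable_fun [set: R] f -> (forall x, 0 <= f x) ->
  (\int[gauss]_x (f x)%:E = \int[mu]_x (f x * phi x)%:E)%E.
Proof.
move=> mf f0; symmetry.
rewrite (@ge0_integral_density_transfer _ _ _ _ _ mu gauss id _ _ 1)//.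
- by rewrite mul1e.
- exact: measurable_normal_pdf.
- exact: normal_pdf_ge0.
- move=> A mA; rewrite mul1e /normal_prob [RHS]integral_mkcond.
  apply: eq_integral => x _; rewrite patchE indicE.
  by case: (x \in A); rewrite ?mul1r ?mul0r.
Qed.

Lemma ge0_integral_normal01N (f : R -> R) :
  measurable_fun [set: R] f -> (forall x, 0 <= f x) ->
  (\int[gauss]_x (f (- x))%:E = \int[gauss]_x (f x)%:E)%E.
Proof.
move=> mf f0; rewrite !ge0_integral_normal01//; last exact: measurableT_comp.
under eq_integral do rewrite -normal_pdf01N.
have mN : measurable_fun [set: measurableTypeR R]
  (-%R : measurableTypeR R -> measurableTypeR R) by [].
pose g x := (f x * phi x)%:E.
transitivity (\int[pushforward mu (-%R : _ -> measurableTypeR R)]_x g x)%E.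
  rewrite ge0_integral_pushforward//.
    by apply/measurable_EFinP/measurable_funM => //; exact: measurable_normal_pdf.
  by move=> x _; rewrite lee_fin mulr_ge0// normal_pdf_ge0.
by apply: eq_measure_integral => //= A mA _; exact: lebesgue_measureN.
Qed.

Lemma cvg_exprn_normal_pdf (k : nat) :
  (n%:R ^+ k.+1 * phi n%:R) @[n --> \oo] --> (0 : R).
Proof.
pose C := k.+1`!%:R * 2 ^+ k.+1 : R.
apply: (@squeeze_cvgr _ _ _ _ (fun=> 0)
    (fun n => normal_peak 1 * (C * n%:R^-1))).
- near=> n; rewrite mulr_ge0 ?exprn_ge0 ?normal_pdf_ge0//=.
  have n1 : (1 : R) <= n%:R by rewrite ler1n; near: n; exists 1%N.
  have n0 : (0 : R) < n%:R by rewrite (lt_le_trans ltr01).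
  rewrite normal_pdf01E mulrCA ler_wpM2l ?normal_peak_ge0//.
  rewrite mulNr expRN ler_pdivrMr ?expR_gt0//.
  have x0 : 0 <= 2^-1 * n%:R ^+ 2 :> R by rewrite mulr_ge0// exprn_ge0// ltW.
  have := expR_ge1Dxn k x0; rewrite -lerBrDl => /le_trans H.
  have {}H : (2^-1 * n%:R ^+ 2) ^+ k.+1 / k.+1`!%:R <= expR (2^-1 * n%:R ^+ 2) :> R.
    by apply: H; rewrite gerBl.
  have C0 : 0 <= C / n%:R by rewrite !mulr_ge0// invr_ge0 ltW.
  apply: le_trans (ler_wpM2l C0 H).
  rewrite [leRHS](_ : _ = n%:R ^+ k * n%:R ^+ k.+1).
    by rewrite ler_peMl ?exprn_ege1// exprn_ge0// ltW.
  rewrite /C exprMn exprVn -exprM mul2n -addnn exprD [n%:R ^+ k.+1]exprS.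
  have k0 : k.+1`!%:R != 0 :> R by rewrite pnatr_eq0 -lt0n fact_gt0.
  have two0 : 2 ^+ k.+1 != 0 :> R by rewrite expf_neq0.
  by field; rewrite k0 two0 gt_eqF.
- exact: cvg_cst.
- rewrite -[X in _ --> X](mulr0 (normal_peak 1)); apply: cvgMl_tmp.
  rewrite -[X in _ --> X](mulr0 C); apply: cvgMl_tmp.
  by apply/gtr0_cvgV0; [near=> n; rewrite ltr0n; near: n; exists 1%N|exact: cvgr_idn].
Unshelve. all: by end_near. Qed.

End standard_normal_moments.

Section standard_normal_moments_values.
Context {R : realType}.
Notation mu := (@lebesgue_measure R).
Local Notation phi := (@normal_pdf R 0 1).
Local Notation gauss := (normal_prob 0 1 : probability (measurableTypeR R) R).

Let continuous_moment k : continuous (fun x : R => x ^+ k * phi x).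
Proof.
move=> x; apply: cvgM; first exact: exprn_continuous.
by apply: continuous_normal_pdf; exact: oner_neq0.
Qed.

Let measurable_moment k : measurable_fun [set: R] (fun x : R => x ^+ k * phi x).
Proof. exact: continuous_measurable_fun. Qed.

Let moment_ge0 k (x : R) : ~~ odd k -> 0 <= x ^+ k * phi x.
Proof. by move=> ek; rewrite mulr_ge0 ?normal_pdf_ge0 ?exprn_even_ge0. Qed.

Let truncated_moment_rec k (n : nat) : ~~ odd k ->
  (\int[mu]_(x in `[0%R, n.+1%:R]) (x ^+ k.+2 * phi x)%:E =
   (- (n.+1%:R ^+ k.+1 * phi n.+1%:R))%:E +
   k.+1%:R%:E * \int[mu]_(x in `[0%R, n.+1%:R]) (x ^+ k * phi x)%:E)%E.
Proof.
move=> ek.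
have cphi : continuous phi by apply: continuous_normal_pdf; exact: oner_neq0.
pose F (x : R) := x ^+ k.+1; pose f (x : R) := k.+1%:R * x ^+ k.
pose G (x : R) := - phi x; pose g (x : R) := x * phi x.
have dF (x : R) : is_derive x 1 F (f x).
  have -> : F = (@id R) ^+ k.+1 by apply/funext => y; rewrite exprfctE.
  by apply: is_derive_eq; rewrite /= /GRing.scale/= mulr1.
have dG (x : R) : is_derive x 1 G (g x).
  have dphi := is_derive_normal_pdf01 x.
  have -> : G = - phi by [].
  by apply: is_derive_eq; rewrite opprK.
have cF : continuous F by exact: exprn_continuous.
have cG : continuous G by move=> x; apply: cvgN; exact: cphi.
have cf : continuous f.
  by move=> x; apply: cvgM; [exact: cvg_cst|exact: exprn_continuous].
have cg : continuous g by move=> x; apply: cvgM; [exact: cvg_id|exact: cphi].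
have oo (H h : R -> R) : continuous H -> (forall x : R, is_derive x 1 H (h x)) ->
    derivable_oo_LRcontinuous H 0 n.+1%:R.
  move=> cH dH; split.
  - by move=> x _; have [] := dH x.
  - exact/cvg_at_right_filter/cH.
  - exact/cvg_at_left_filter/cH.
have D1 (H h : R -> R) : (forall x : R, is_derive x 1 H (h x)) ->
    {in `]0, n.+1%:R[, derive1 H =1 h}.
  by move=> dH x _; rewrite derive1E; have [] := dH x.
have n0 : (0 : R) < n.+1%:R by [].
have := integration_by_parts n0 (continuous_subspaceT cf) (oo _ _ cF dF)
  (D1 _ _ dF) (continuous_subspaceT cg) (oo _ _ cG dG) (D1 _ _ dG).
rewrite /F /G /f /g => E.
under eq_integral do rewrite exprSr -mulrA.
rewrite E expr0n mul0r subr0 mulrN; congr (_ + _)%E.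
under eq_integral do rewrite mulrN EFinN.
rewrite integral_ge0N; last first.
  by move=> x _; rewrite -mulrA lee_fin mulr_ge0// moment_ge0.
rewrite oppeK; under eq_integral do rewrite -mulrA EFinM.
rewrite ge0_integralZl//.
- by apply/measurable_EFinP; apply: measurable_funTS; exact: measurable_moment.
- by move=> x _; rewrite lee_fin; exact: moment_ge0.
Qed.

Let half_moment_rec k : ~~ odd k ->
  (\int[mu]_(x in `[0%R, +oo[) (x ^+ k.+2 * phi x)%:E =
   k.+1%:R%:E * \int[mu]_(x in `[0%R, +oo[) (x ^+ k * phi x)%:E)%E.
Proof.
move=> ek.
have c m : ~~ odd m ->
    (\int[mu]_(x in `[0%R, n.+1%:R]) (x ^+ m * phi x)%:E)%E @[n --> \oo] -->
    (\int[mu]_(x in `[0%R, +oo[) (x ^+ m * phi x)%:E)%E.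
  move=> em; rewrite (cvg_shiftS (fun n =>
    (\int[mu]_(x in `[0%R, n%:R]) (x ^+ m * phi x)%:E)%E)).
  by apply: ge0_cvgn_integral => [x|]; [exact: moment_ge0|exact: measurable_moment].
have ek2 : ~~ odd k.+2 by rewrite /= negbK.
have E : (fun n => \int[mu]_(x in `[0%R, n.+1%:R]) (x ^+ k.+2 * phi x)%:E)%E =
    (fun n => (- (n.+1%:R ^+ k.+1 * phi n.+1%:R))%:E +
   k.+1%:R%:E * \int[mu]_(x in `[0%R, n.+1%:R]) (x ^+ k * phi x)%:E)%E.
  by apply/funext => n; exact: truncated_moment_rec.
have c2 := c _ ek2; rewrite E in c2.
have lim0 : ((- (n.+1%:R ^+ k.+1 * phi n.+1%:R))%:E : \bar R) @[n --> \oo] --> 0%E.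
  apply: cvg_EFin; first exact: nearW.
  rewrite -[X in _ --> X]oppr0; apply: cvgN.
  by have := cvg_exprn_normal_pdf (R := R) k; rewrite -cvg_shiftS.
have limJ := cvgeZl (isT : k.+1%:R%:E \is a fin_num) (c _ ek).
have lim := cvgeD (fin_num_adde_defr _ (isT : 0%E \is a fin_num)) lim0 limJ.
rewrite add0e in lim.
by apply: (cvg_unique _ c2) => //; exact: lim.
Qed.

Lemma normal01_moment_even k : (\int[gauss]_x (x ^+ k.*2)%:E =
  (\prod_(i < k) i.*2.+1%:R)%:E)%E.
Proof.
have ek m : ~~ odd m.*2 by rewrite odd_double.
have half m : (\int[gauss]_x (x ^+ m.*2)%:E =
    2%:E * \int[mu]_(x in `[0%R, +oo[) (x ^+ m.*2 * phi x)%:E)%E.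
  rewrite ge0_integral_normal01//; last by move=> x; rewrite exprn_even_ge0.
  rewrite ge0_symfun_integralT//.
  - by rewrite set_itvcy.
  - by move=> x; exact: moment_ge0.
  - by move=> x /=; rewrite normal_pdf01N -!mul2n !exprM sqrrN.
elim: k => [|k IH].
  rewrite big_ord0; under eq_integral do rewrite expr0.
  by rewrite integral_cst// mul1e; exact: (@probability_setT _ _ _ gauss).
by rewrite half doubleS half_moment_rec// muleCA -half IH -EFinM big_ord_recr mulrC.
Qed.

Lemma integrable_normal01_exprn n : gauss.-integrable [set: R]
  (EFin \o (fun x => x ^+ n)).
Proof.
have i2 k : gauss.-integrable [set: R] (EFin \o (fun x => x ^+ k.*2)).
  apply/integrableP; split; first exact/measurable_EFinP/measurable_funX.
  under eq_integral do rewrite /= ger0_norm ?exprn_even_ge0 ?odd_double//.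
  by rewrite normal01_moment_even ltry.
apply: (le_integrable _ _ _ (integrableD_EFin (i2 0%N) (i2 n))) => //.
  exact/measurable_EFinP/measurable_funX.
move=> x _; rewrite lee_fin; apply: le_trans (ler_norm _).
rewrite expr0 -muln2 exprM -real_normK ?num_real//.
have := sqr_ge0 (`|x ^+ n| - 1); nra.
Qed.

Lemma normal01_moment_odd n : odd n -> \int[gauss]_x (x ^+ n) = 0.
Proof.
move=> on; have i1 := integrable_normal01_exprn n.
have i1n := integrable_norm i1.
have := @ge0_integral_normal01N R (fun x => `|x ^+ n| + x ^+ n).
have -> : (\int[gauss]_x (`|(- x) ^+ n| + (- x) ^+ n)%:E =
    (\int[gauss]_x `|x ^+ n| - \int[gauss]_x (x ^+ n))%R%:E)%E.
  rewrite -RintegralB// -EFin_Rintegral; last exact: integrableB_EFin.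
  apply: eq_integral => x _.
  by rewrite normrX normrN -normrX exprNn -signr_odd on expr1 mulN1r.
rewrite EFin_Rintegral ?RintegralD//; last exact: integrableD_EFin.
set a := \int[gauss]_x `|x ^+ n|; set b := \int[gauss]_x (x ^+ n) => H.
have {}H : ((a - b)%:E = (a + b)%:E)%E.
  apply: H => [|x]; last by rewrite -lerBlDr sub0r -normrN ler_norm.
  apply: measurable_funD; last exact: measurable_funX.
  by apply: measurableT_comp => //; exact: measurable_funX.
by have [] := H; lra.
Qed.

End standard_normal_moments_values.

Section gaussian_vector.
Context dT (T : measurableType dT) (R : realType) (P : probability T R) (d : nat).
Variable X : T -> 'cV[R]_d.
Hypothesis mX : forall j : 'I_d, measurable_fun [set: T] (fun w => X w j 0).
Hypothesis gX : std_gaussian_vec P X.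
Local Notation gauss := (normal_prob 0 1 : probability (measurableTypeR R) R).

Lemma gaussian_mixed_moment (n : 'I_d -> nat) :
  \int[P]_w (\prod_(j < d) (X w j 0) ^+ n j) =
  \prod_(j < d) \int[gauss]_x (x ^+ n j).
Proof.
have [|_ <-//] := @expectation_prod_iid _ _ _ P _ _ gauss d
  (fun j w => X w j 0) mX gX (fun j x => x ^+ n j).
by move=> j; exact: integrable_normal01_exprn.
Qed.

Lemma gaussian_fourth_moment (a b c e : 'I_d) :
  \int[P]_w (X w a 0 * X w b 0 * X w c 0 * X w e 0) =
  ((a == b) && (c == e))%:R + ((a == c) && (b == e))%:R
  + ((a == e) && (b == c))%:R.
Proof.
pose n (j : 'I_d) := ((a == j) + (b == j) + (c == j) + (e == j))%N.
have prodX w i : \prod_(j < d) X w j 0 ^+ (i == j) = X w i 0.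
  rewrite (bigD1 i)//= eqxx expr1 big1 ?mulr1// => j.
  by rewrite eq_sym => /negPf ->.
transitivity (\int[P]_w (\prod_(j < d) (X w j 0) ^+ n j)).
  apply: eq_Rintegral => w _; under [RHS]eq_bigr do rewrite !exprD.
  by rewrite !big_split/= !prodX.
rewrite gaussian_mixed_moment.
have m0 : \int[gauss]_x (x ^+ 0) = 1 :> R.
  by rewrite /Rintegral (normal01_moment_even 0) big_ord0.
have m2 : \int[gauss]_x (x ^+ 2) = 1 :> R.
  by rewrite /Rintegral (normal01_moment_even 1) big_ord_recl big_ord0 mulr1.
have m4 : \int[gauss]_x (x ^+ 4) = 3 :> R.
  by rewrite /Rintegral (normal01_moment_even 2) !big_ord_recl big_ord0 mulr1 mul1r.
have odd0 j : odd (n j) -> \prod_(j < d) \int[gauss]_x (x ^+ n j) = 0.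
  by move=> nj; rewrite (bigD1 j)//= normal01_moment_odd// mul0r.
have even1 : (forall j, n j = 0%N \/ n j = 2%N) ->
    \prod_(j < d) \int[gauss]_x (x ^+ n j) = 1.
  by move=> nj; apply: big1 => j _; have [->|->] := nj j.
have [ab|ab] := eqVneq a b.
  have [ce|ce] := eqVneq c e.
    have [ac|ac] := eqVneq a c.
      subst; rewrite eqxx (bigD1 e)//= /n eqxx m4 big1 ?mulr1 => [|j].
        by rewrite -!natrD.
      by rewrite eq_sym => /negPf ->.
    subst; rewrite (negPf ac) !addr0 even1// => j.
    rewrite /n; have [aj|aj] := eqVneq b j; last by case: eqP; [right|left].
    by move: ac; rewrite aj eq_sym => /negPf ->; right.
  subst; rewrite (@odd0 c) ?andbF/=; last first.
    by rewrite /n eqxx [e == c]eq_sym (negPf ce); case: eqP.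
  have [->|//] := eqVneq b c; last by rewrite andbF !addr0.
  by rewrite (negPf ce) !addr0.
rewrite /= add0r; have [ac|ac] := eqVneq a c.
  subst; have [be|be] := eqVneq b e.
    subst; rewrite (negPf ab) addr0 even1// => j.
    rewrite /n; have [cj|cj] := eqVneq c j; last by case: eqP; [right|left].
    by move: ab; rewrite cj eq_sym => /negPf ->; right.
  rewrite (@odd0 b) /=; last by rewrite /n eqxx (negPf ab) [e == b]eq_sym (negPf be).
  by rewrite [b == c]eq_sym (negPf ab) andbF addr0.
rewrite /= add0r; have [ae|ae] := eqVneq a e.
  subst; have [bc|bc] := eqVneq b c.
    subst; rewrite even1// => j.
    rewrite /n; have [ej|ej] := eqVneq e j; last by case: eqP; [right|left].
    by move: ac; rewrite ej eq_sym => /negPf ->; right.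
  by rewrite (@odd0 b)// /n eqxx (negPf ab) [c == b]eq_sym (negPf bc).
by rewrite (@odd0 a)// /n eqxx ![_ == a]eq_sym (negPf ab) (negPf ac) (negPf ae).
Qed.

End gaussian_vector.

(** * Discrete Fourier transform *)

Lemma sum_mxtens (V : nmodType) (m n : nat) (f : 'I_(m * n) -> V) :
  \sum_k f k = \sum_(i < m) \sum_(j < n) f (mxtens_index (i, j)).
Proof.
rewrite pair_big/= (reindex (@mxtens_index m n)) /=.
  by apply: eq_bigr => -[].
by exists (@mxtens_unindex m n) => k _; rewrite ?mxtens_indexK ?mxtens_unindexK.
Qed.

Section characters.
Context (R : realType) (n : nat).
Local Notation d := n.+1.
Local Notation C := (R[i])%C.
Local Notation F := (@dft R d).

Let omega : C := (Complex (cos (2 * pi / d%:R)) (- sin (2 * pi / d%:R)))%C.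

Let omegaX m : omega ^+ m =
  (Complex (cos (2 * pi * m%:R / d%:R)) (- sin (2 * pi * m%:R / d%:R)))%C.
Proof.
elim: m => [|m IH]; first by rewrite !(mulr0, mul0r) cos0 sin0 oppr0.
rewrite exprS IH /omega -[m.+1%:R]natr1.
have -> : 2 * pi * (m%:R + 1) / d%:R = 2 * pi / d%:R + 2 * pi * m%:R / d%:R :> R.
  by rewrite mulrDr mulr1 mulrDl addrC.
rewrite cosD sinD; apply/eqP; rewrite eq_complex /=; apply/andP; split; apply/eqP; ring.
Qed.

Let omegaXd : omega ^+ d = 1.
Proof.
rewrite omegaX mulfK ?pnatr_eq0//.
rewrite [2 * _]mulr_natl cos2pi sin2pi oppr0.
by apply/eqP; rewrite eq_complex /= !eqxx.
Qed.

Let omega_neq1 m : (0 < m < d)%N -> omega ^+ m != 1.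
Proof.
move=> /andP[m0 md]; rewrite omegaX eq_complex/= negb_and; apply/orP; left.
pose y : R := pi * m%:R / d%:R.
have -> : 2 * pi * m%:R / d%:R = y *+ 2 :> R by rewrite -[RHS]mulr_natl /y !mulrA.
have y0 : 0 < y by rewrite divr_gt0 ?mulr_gt0 ?pi_gt0 ?ltr0n.
have ypi : y < pi by rewrite /y ltr_pdivrMr ?ltr0n// ltr_pM2l ?pi_gt0// ltr_nat.
have sy : 0 < sin y by rewrite sin_gt0_pi// y0.
rewrite cos_mulr2n lt_eqF// ltrBlDr -mulr2n ltr_pMn2r//.
by rewrite -[ltRHS](cos2Dsin2 y) ltrDl exprn_gt0.
Qed.

Let conj_omega : Num.conj omega * omega = 1.
Proof.
rewrite mulrC -normCK normc_def /= sqrrN cos2Dsin2 sqrtr1.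
by rewrite expr1n.
Qed.

Definition chi (i k : 'I_d) : C := omega ^+ (i * k).

Lemma chiC i k : chi i k = chi k i. Proof. by rewrite /chi mulnC. Qed.

Lemma chiDl i j k : chi (i + j) k = chi i k * chi j k.
Proof.
rewrite /chi -exprD -mulnDl /= -(expr_mod ((i + j) * k) omegaXd).
by rewrite -modnMml expr_mod.
Qed.

Lemma chi0l k : chi 0 k = 1. Proof. by rewrite /chi mul0n. Qed.

Lemma chiNl i k : chi (- i) k = Num.conj (chi i k).
Proof.
have cK : Num.conj (chi i k) * chi i k = 1.
  by rewrite /chi rmorphXn -exprMn conj_omega expr1n.
by rewrite -[LHS]mul1r -cK -mulrA -chiDl subrr chi0l mulr1.
Qed.

Lemma chiNr i k : chi i (- k) = chi (- i) k.
Proof. by rewrite chiC !chiNl chiC. Qed.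

Lemma sum_chi i : \sum_k chi i k = (d%:R *+ (i == 0)).
Proof.
have [->|i0] := eqVneq i 0.
  under eq_bigr do rewrite chi0l.
  by rewrite sumr_const card_ord.
have wi : omega ^+ i - 1 != 0.
  rewrite subr_eq0 omega_neq1// ltn_ord andbT lt0n.
  by apply: contra i0 => /eqP H; apply/eqP/val_inj.
apply: (mulfI wi); rewrite mulr0.
under eq_bigr do rewrite /chi exprM.
by rewrite -subrX1 exprAC omegaXd expr1n subrr.
Qed.

Let s : C := ((Num.sqrt (d%:R : R))%:C)%C.

Let s2 : s ^-1 * s ^-1 = d%:R^-1.
Proof.
rewrite -invfM -rmorphM -expr2 sqr_sqrtr// rmorph_nat.
by [].
Qed.

Lemma dft_chi i k : F i k = s^-1 * chi i k :> C.
Proof.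
rewrite mxE /chi omegaX natrM fmorphV.
by [].
Qed.


Lemma conj_dft i k : Num.conj (F i k) = s^-1 * chi (- i) k.
Proof.
rewrite dft_chi rmorphM chiNl; congr (_ * _).
by rewrite fmorphV; congr (_^-1); exact: conjc_real.
Qed.

Lemma rowdot_dft i j : rowdot F i j = (i + j == 0)%:R.
Proof.
rewrite /rowdot; under eq_bigr do rewrite !dft_chi mulrACA s2 -chiDl.
rewrite -mulr_sumr sum_chi; case: eqP => _; last by rewrite mulr0.
by rewrite mulVf// pnatr_eq0.
Qed.

Lemma dft_sqr : F *m F = \matrix_(i, j) (i + j == 0)%:R.
Proof.
apply/matrixP => i j; rewrite !mxE -rowdot_dft; apply: eq_bigr => k _.
by rewrite !dft_chi (chiC k).
Qed.

Lemma dft_sqr_conj : F *m F *m conj_mx F = F.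
Proof.
rewrite dft_sqr; apply/matrixP => i j; rewrite mxE (bigD1 (- i))//= big1 => [|k ki].
  by rewrite mxE subrr eqxx mul1r addr0 mxE conj_dft opprK dft_chi.
rewrite mxE (_ : _ == 0 = false) ?mul0r//.
by apply: contraNF ki; rewrite addrC addr_eq0.
Qed.

Let weight (k : 'I_(d * d)) : C :=
  let i := (mxtens_unindex k).1 in let j := (mxtens_unindex k).2 in
  1 + (i == j)%:R + (i + j == 0)%:R.

(* On the support of [F^2 *t F^2], where [i' = -i] and [j' = -j], the three
   terms of [M] become [[i + j = 0]], [[i = j]] and [1]. *)
Lemma hadamard_dft :
  hadamard ((F *t F) *m (F *t F)) (@Mmat R d) =
  diag_mx (\row_k weight k) *m ((F *m F) *t (F *m F)) :> 'M[C]_(d * d).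
Proof.
rewrite tensmx_mul dft_sqr; apply/matrixP => a b.
case: (mxtens_indexP a) => i j; case: (mxtens_indexP b) => i' j'.
rewrite mul_diag_mx !mxE /weight !mxtens_indexK/= mulrC.
have [ii|_] := eqVneq (i + i') 0; last by rewrite !mul0r !mulr0.
have [jj|_] := eqVneq (j + j') 0; last by rewrite !mulr0.
have -> : i' = - i by apply/eqP; rewrite -addr_eq0 addrC ii.
have -> : j' = - j by apply/eqP; rewrite -addr_eq0 addrC jj.
rewrite !mulr1 !rowdot_dft -opprD oppr_eq0 !subrr eqxx !subr_eq0 addrC.
rewrite (addrC (- i)) subr_eq0 (eq_sym j) mulr1 -!natrM !mulnb !andbb.
by rewrite [X in _ + X]addrC addrA.
Qed.

Lemma dft_sandwich (a b a' b' : 'I_d) :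
  (conj_mx (F *t F) *m hadamard ((F *t F) *m (F *t F)) (@Mmat R d)
     *m conj_mx (F *t F)) (mxtens_index (a, b)) (mxtens_index (a', b')) =
  ((a == a') && (b == b'))%:R + d%:R^-1 * (a + b == a' + b')%:R
  + d%:R^-1 * (a - b == a' - b')%:R :> C.
Proof.
have conjT : conj_mx (F *t F) = conj_mx F *t conj_mx F :> 'M[C]_(d * d).
  exact: map_mxT.
have shuffle (A : comPzRingType) (v w x y z u : A) :
    v * x * (v * y) * (w * (v * z * (v * u))) =
    v * v * (v * v) * (z * x * (u * y)) * w by ring.
rewrite hadamard_dft -!mulmxA conjT tensmx_mul dft_sqr_conj.
rewrite mxE sum_mxtens.
pose t (i j : 'I_d) : C := d%:R^-1 * d%:R^-1 * (chi (a' - a) i * chi (b' - b) j).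
have E i j : (conj_mx F *t conj_mx F) (mxtens_index (a, b)) (mxtens_index (i, j)) *
    (diag_mx (\row_k weight k) *m (F *t F))
      (mxtens_index (i, j)) (mxtens_index (a', b')) =
    t i j * (1 + (i == j)%:R + (i + j == 0)%:R).
  rewrite tensmxE mul_diag_mx [X in _ * X]mxE tensmxE.
  rewrite [(\row_k weight k) _ _]mxE /weight !mxtens_indexK/=.
  rewrite [conj_mx F a i]mxE [conj_mx F b j]mxE !conj_dft !dft_chi.
  rewrite /t !chiDl -s2 (chiC a' i) (chiC b' j).
  exact: shuffle.
have n0 : (d%:R : C) != 0 by rewrite pnatr_eq0.
have dsum (x : 'I_d) : d%:R^-1 * \sum_i chi x i = (x == 0)%:R.
  by rewrite sum_chi; case: (x == 0); rewrite ?mulr0// mulVf.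
under eq_bigr do under eq_bigr do rewrite E !mulrDr mulr1.
under eq_bigr do rewrite !big_split/=.
rewrite !big_split/=; congr (_ + _ + _).
- transitivity ((d%:R^-1 * \sum_i chi (a' - a) i) * (d%:R^-1 * \sum_j chi (b' - b) j)).
    rewrite mulrACA mulr_suml mulr_sumr; apply: eq_bigr => i _.
    by rewrite mulr_sumr mulr_sumr.
  by rewrite !dsum !subr_eq0 -natrM mulnb (eq_sym a') (eq_sym b').
- transitivity (\sum_i t i i).
    apply: eq_bigr => i _; rewrite (bigD1 i)//= eqxx mulr1 big1 ?addr0// => j.
    by rewrite eq_sym => /negPf ->; rewrite mulr0.
  rewrite /t -mulr_sumr; under eq_bigr do rewrite -chiDl.
  rewrite -mulrA dsum addrACA -opprD subr_eq0; congr (_ * (_)%:R).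
  by rewrite eq_sym.
- transitivity (\sum_i t i (- i)).
    apply: eq_bigr => i _; rewrite (bigD1 (- i))//= subrr eqxx mulr1.
    rewrite big1 ?addr0// => j ji; rewrite (_ : _ == 0 = false) ?mulr0//.
    by apply: contraNF ji; rewrite addrC addr_eq0.
  rewrite /t -mulr_sumr; under eq_bigr do rewrite chiNr -chiDl.
  rewrite -mulrA dsum; congr (_ * (nat_of_bool _)%:R).
  rewrite -[LHS]oppr_eq0 -[RHS]subr_eq0 !opprB; congr (_ == _).
  by rewrite addrC addrACA [RHS]addrACA; congr (_ + _); exact: addrC.
Qed.

End characters.

(** * Fisher information of the quadratic network *)

Section expected_matrix.
Context dT (T : measurableType dT) (R : realType) (P : probability T R).

Lemma EmxE (m n : nat) (Y : T -> 'M[R]_(m, n)) i j :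
  Emx P Y i j = \int[P]_w (Y w i j).
Proof. by rewrite mxE unlock. Qed.

Definition integrable_mx (m n : nat) (Y : T -> 'M[R]_(m, n)) :=
  forall i j, P.-integrable [set: T] (EFin \o (fun w => Y w i j)).

Lemma integrable_sum_EFin (I : Type) (r : seq I) (Q : pred I) (f : I -> T -> R) :
  (forall i, Q i -> P.-integrable [set: T] (EFin \o f i)) ->
  P.-integrable [set: T] (EFin \o (fun w => \sum_(i <- r | Q i) f i w)).
Proof.
move=> fi; have := integrable_sum measurableT r fi.
by under eq_fun do rewrite sumEFin.
Qed.

Lemma Rintegral_sum (I : Type) (r : seq I) (Q : pred I) (f : I -> T -> R) :
  (forall i, Q i -> P.-integrable [set: T] (EFin \o f i)) ->
  \int[P]_w (\sum_(i <- r | Q i) f i w) = \sum_(i <- r | Q i) \int[P]_w f i w.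
Proof.
move=> fi; elim: r => [|i r IH].
  under eq_Rintegral do rewrite big_nil.
  by rewrite big_nil Rintegral_cst// mul0r.
under eq_Rintegral do rewrite big_cons.
rewrite big_cons; case: ifPn => // Qi.
by rewrite RintegralD// ?IH//; [exact: fi|exact: integrable_sum_EFin].
Qed.

Lemma Emx_mull (m n p : nat) (A : 'M[R]_(m, n)) (Y : T -> 'M[R]_(n, p)) :
  integrable_mx Y -> Emx P (fun w => A *m Y w) = A *m Emx P Y.
Proof.
move=> iY; apply/matrixP => i j; rewrite EmxE mxE.
under eq_Rintegral do rewrite mxE.
rewrite Rintegral_sum; last by move=> k _; exact: integrableZ_EFin.
by apply: eq_bigr => k _; rewrite EmxE RintegralZl.
Qed.

Lemma Emx_scale (m n : nat) (c : R) (Y : T -> 'M[R]_(m, n)) :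
  integrable_mx Y -> Emx P (fun w => c *: Y w) = c *: Emx P Y.
Proof.
move=> iY; apply/matrixP => i j; rewrite EmxE !mxE.
under eq_Rintegral do rewrite mxE.
by rewrite RintegralZl// unlock.
Qed.

Lemma integrable_mx_mull (m n p : nat) (A : 'M[R]_(m, n)) (Y : T -> 'M[R]_(n, p)) :
  integrable_mx Y -> integrable_mx (fun w => A *m Y w).
Proof.
move=> iY i j; under eq_fun do rewrite /= mxE.
by apply: integrable_sum_EFin => k _; exact: integrableZ_EFin.
Qed.

End expected_matrix.

Section quadratic_network.
Context (R : realType) (d p : nat) (W : 'M[R]_(p, d)).
Let sigma : R -> R := fun u => u ^+ 2 / 2.

Lemma tensmxZ (m n q r : nat) (c : R) (A : 'M[R]_(m, n)) (B : 'M[R]_(q, r)) :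
  (c *: A) *t (c *: B) = c ^+ 2 *: (A *t B).
Proof. by apply/matrixP => i j; rewrite !mxE mulrACA. Qed.

Lemma gradf_tens (f : R -> R) (x : 'cV[R]_d) :
  gradf f W x *t gradf f W x =
  (map_mx (derive1 f) (W *m x) *t map_mx (derive1 f) (W *m x)) *m (x *t x)^T.
Proof. by rewrite /gradf trmx_tens tensmx_mul. Qed.

Lemma derive1_half_sqr : derive1 sigma = id.
Proof.
apply/funext => u; rewrite derive1E.
have -> : sigma = 2^-1 \*: ((@id R) ^+ 2).
  by apply/funext => v; rewrite /sigma mulrC.
rewrite derive_val /GRing.scale/= expr1 mulr1.
by field.
Qed.

Lemma gradf_half_sqr (x : 'cV[R]_d) : gradf sigma W x = W *m (x *m x^T).
Proof. by rewrite /gradf derive1_half_sqr map_mx_id// mulmxA. Qed.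

Lemma sum_cshift_outer (x : 'cV[R]_d) :
  \sum_(i < d) cshift i x *m (cshift i x)^T = circulant x *m (circulant x)^T.
Proof.
apply/matrixP => a b; rewrite summxE mxE; apply: eq_bigr => i _.
by rewrite !mxE big_ord1 !mxE.
Qed.

Lemma avg_gradf_half_sqr (x : 'cV[R]_d) :
  avg_gradf sigma W x = d%:R^-1 *: (W *m (circulant x *m (circulant x)^T)).
Proof.
rewrite /avg_gradf; congr (_ *: _).
under eq_bigr do rewrite gradf_half_sqr.
by rewrite -mulmx_sumr sum_cshift_outer.
Qed.

End quadratic_network.

Section fourth_moments.
Context dT (T : measurableType dT) (R : realType) (P : probability T R) (d : nat).
Variable X : T -> 'cV[R]_d.
Hypothesis iX : forall a b c e : 'I_d, P.-integrable [set: T]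
  (fun w => (X w a 0 * X w b 0 * X w c 0 * X w e 0)%:E).

Lemma integrable_outer_tens :
  integrable_mx P (fun w => (X w *m (X w)^T) *t (X w *m (X w)^T)).
Proof.
move=> i j; case: (mxtens_indexP i) => a b; case: (mxtens_indexP j) => a' b'.
under eq_fun do rewrite /= tensmxE !mxE !big_ord1 !mxE mulrA.
exact: iX.
Qed.

Lemma circulant_tensE (x : 'cV[R]_d) (a b a' b' : 'I_d) :
  ((circulant x *m (circulant x)^T) *t (circulant x *m (circulant x)^T))
    (mxtens_index (a, b)) (mxtens_index (a', b')) =
  \sum_(k < d) \sum_(l < d)
    circulant x a k * circulant x a' k * circulant x b l * circulant x b' l.
Proof.
rewrite tensmxE !mxE mulr_suml; apply: eq_bigr => k _.
rewrite mulr_sumr; apply: eq_bigr => l _.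
by rewrite ![_^T _ _]mxE !mulrA.
Qed.

Lemma integrable_circulant_tens :
  integrable_mx P (fun w => (circulant (X w) *m (circulant (X w))^T)
                         *t (circulant (X w) *m (circulant (X w))^T)).
Proof.
move=> i j; case: (mxtens_indexP i) => a b; case: (mxtens_indexP j) => a' b'.
under eq_fun do rewrite /= circulant_tensE.
apply: integrable_sum_EFin => k _; apply: integrable_sum_EFin => l _.
under eq_fun do rewrite /= !mxE.
exact: iX.
Qed.

End fourth_moments.

Section gaussian_circulant.
Context dT (T : measurableType dT) (R : realType) (P : probability T R) (n : nat).
Local Notation d := n.+1.
Variable X : T -> 'cV[R]_d.
Hypothesis mX : forall j : 'I_d, measurable_fun [set: T] (fun w => X w j 0).
Hypothesis gX : std_gaussian_vec P X.
Hypothesis iX : forall a b c e : 'I_d, P.-integrable [set: T]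
  (fun w => (X w a 0 * X w b 0 * X w c 0 * X w e 0)%:E).

Lemma circulantE (x : 'cV[R]_d) (i j : 'I_d) : circulant x i j = x (i - j) 0.
Proof.
rewrite mxE; congr (x _ _); apply/val_inj => /=.
by rewrite modnDmr.
Qed.

Let sum_shift_pairs (a b a' b' : 'I_d) :
  \sum_(k < d) \sum_(l < d) ((a - k == b - l) && (a' - k == b' - l))%:R =
  d%:R * (a - b == a' - b')%:R :> R.
Proof.
rewrite (eq_bigr (fun=> (a - b == a' - b')%:R)) => [|k _].
  by rewrite sumr_const card_ord mulr_natl.
have subC (x y z t : 'I_d) : (x - y == z - t) = (x - z == y - t).
  rewrite -[LHS]subr_eq0 -[RHS]subr_eq0 !opprB; congr (_ == _).
  by rewrite addrACA [RHS]addrACA; congr (_ + _); exact: addrC.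
rewrite (bigD1 (k - (a - b)))//= big1 ?addr0 => [|l lk].
  by rewrite subC [a' - k == _]subC opprB addrCA subrr addr0 eqxx eq_sym.
rewrite subC; case: eqP => //= abkl.
by case/eqP: lk; rewrite abkl opprB addrCA subrr addr0.
Qed.

Lemma Emx_gaussian_circulant (a b a' b' : 'I_d) :
  (d%:R ^- 2 *: Emx P (fun w => (circulant (X w) *m (circulant (X w))^T)
                *t (circulant (X w) *m (circulant (X w))^T)))
    (mxtens_index (a, b)) (mxtens_index (a', b')) =
  ((a == a') && (b == b'))%:R + d%:R^-1 * (a + b == a' + b')%:R
  + d%:R^-1 * (a - b == a' - b')%:R.
Proof.
have n0 : (d%:R : R) != 0 by rewrite pnatr_eq0.
rewrite mxE EmxE; under eq_Rintegral do rewrite circulant_tensE.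
have iC k l : P.-integrable [set: T] (EFin \o (fun w => circulant (X w) a k *
    circulant (X w) a' k * circulant (X w) b l * circulant (X w) b' l)).
  by under eq_fun do rewrite /= !circulantE; exact: iX.
rewrite Rintegral_sum => [|k _]; last exact: integrable_sum_EFin.
under eq_bigr => k _.
  rewrite Rintegral_sum//.
  under eq_bigr => l _.
    under eq_Rintegral do rewrite !circulantE.
    rewrite gaussian_fourth_moment//.
    over.
  rewrite !big_split/=.
  over.
rewrite !big_split/= !mulrDr addrAC; congr (_ + _ + _).
- under eq_bigr do under eq_bigr do rewrite !(inj_eq (addIr _)).
  by rewrite !sumr_const !card_ord -mulrnA -[_ *+ (_ * _)]mulr_natl mulrA mulnn natrX
    mulVf ?mul1r// expf_neq0.
- rewrite sum_shift_pairs mulrA expr2 invfM mulfVK//.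
  congr (_ * (nat_of_bool _)%:R).
  rewrite -[LHS]subr_eq0 -[RHS]subr_eq0 opprB opprD; congr (_ == _).
  by rewrite addrACA; congr (_ + _); exact: addrC.
- by rewrite sum_shift_pairs mulrA expr2 invfM mulfVK.
Qed.

End gaussian_circulant.

Theorem theorem5p2 (R : realType) (dT : measure_display) (T : measurableType dT)
  (P : probability T R) (d p : nat) (X : T -> 'cV[R]_d) (W : 'M[R]_(p, d))
  (sigma : R -> R) :
  (forall j : 'I_d, measurable_fun setT (fun w => X w j 0)) ->
  (* part 1, general activation *)
  Fisher P X sigma W
    = Emx P (fun w => (map_mx (derive1 sigma) (W *m X w)
                       *t map_mx (derive1 sigma) (W *m X w)) *m (X w *t X w)^T)
  /\
  (sigma = (fun u => u ^+ 2 / 2) ->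
   (* all expectations finite (fourth moments of X) *)
   (forall a b c e : 'I_d,
      P.-integrable setT (fun w => (X w a 0 * X w b 0 * X w c 0 * X w e 0)%:E)) ->
   (* part 1, quadratic activation *)
   Fisher P X sigma W = (W *t W) *m Emx P (fun w => (X w *m (X w)^T) *t (X w *m (X w)^T))
   (* part 2 *)
   /\ Fisher_bar P X sigma W
      = (W *t W) *m ((d%:R ^+ 2)^-1 *:
           Emx P (fun w => (circulant (X w) *m (circulant (X w))^T)
                            *t (circulant (X w) *m (circulant (X w))^T)))
   /\ (std_gaussian_vec P X ->
       cmx (Fisher_bar P X sigma W)
       = cmx (W *t W) *m conj_mx (dft d *t dft d)
           *m hadamard ((dft d *t dft d) *m (dft d *t dft d)) (Mmat d)
           *m conj_mx (dft d *t dft d))).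
Proof.
move=> mX; split.
  by rewrite /Fisher; congr (Emx P _); apply/funext => w; exact: gradf_tens.
move=> -> iX; have iC := integrable_circulant_tens iX.
have FbarE : Fisher_bar P X (fun u => u ^+ 2 / 2) W =
    (W *t W) *m ((d%:R ^+ 2)^-1 *:
      Emx P (fun w => (circulant (X w) *m (circulant (X w))^T)
                       *t (circulant (X w) *m (circulant (X w))^T))).
  rewrite -scalemxAr -Emx_mull// -Emx_scale; last exact: integrable_mx_mull.
  rewrite /Fisher_bar; congr (Emx P _); apply/funext => w.
  by rewrite avg_gradf_half_sqr tensmxZ -tensmx_mul exprVn.
split; [|split=> //].
  rewrite -Emx_mull; last exact: integrable_outer_tens.
  rewrite /Fisher; congr (Emx P _); apply/funext => w.
  by rewrite gradf_half_sqr -tensmx_mul.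
move=> gX; rewrite FbarE.
case: d => [|n] in X W mX iX iC FbarE gX *.
  by apply/matrixP => i [].
rewrite [cmx _]map_mxM -!mulmxA; congr (_ *m _).
apply/matrixP => i j; case: (mxtens_indexP i) => a b; case: (mxtens_indexP j) => a' b'.
rewrite mulmxA dft_sandwich mxE Emx_gaussian_circulant//.
by rewrite !rmorphD !rmorphM !fmorphV !rmorph_nat.
Qed.
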